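(* Let $(a,B)$ be the coefficients of the quadratic vector equation of a supercritical positive regular Markovian binary tree (SPR-MBT), with extinction probability $x^{\ast}$, i.e. $x^{\ast}$ is the minimal nonnegative solution of $x=a+B(x\otimes x)$. Let $(\tilde a,\widetilde B)$ (of the same dimension $n$) be the coefficients of the quadratic vector equation $\tilde x=\tilde a+\widetilde B(\tilde x\otimes\tilde x)$ of a perturbed Markovian binary tree which is still an SPR-MBT, with extinction probability $\tilde x^{\ast}$ (the minimal nonnegative solution of the perturbed equation). Put $\Delta B=\widetilde B-B$, $L=I-B(x^{\ast}\otimes I+I\otimes x^{\ast})$ (which is nonsingular), and $$\delta=\|\Delta B\|,\quad \ell=\|L^{-1}\|,\quad \tilde b=\|B+\Delta B\|,\quad d=\|x^{\ast}\otimes x^{\ast}-e\otimes e\|.$$ If $$\|x^{\ast}\|\delta+\sqrt{\tilde b\, d\,\delta}\le\frac{1}{2\ell}$$ and $$2\ell\delta\|x^{\ast}\|+\sqrt{(1-2\ell\delta\|x^{\ast}\|)^2-4\ell^2\tilde b d\delta}>\max\{1-2\ell\tilde b(1-\|x^{\ast}\|),\;1-2\ell\tilde b(1-\|e-x^{\ast}\|)\},$$ then $$\|\tilde x^{\ast}-x^{\ast}\|\le \xi_{\ast},\qquad \xi_{\ast}=\frac{2\ell d\delta}{1-2\ell\delta\|x^{\ast}\|+\sqrt{(1-2\ell\delta\|x^{\ast}\|)^2-4\ell^2\tilde b d\delta}}.$$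
   Context: Notation: $\|\cdot\|$ is the infinity norm of vectors and the induced infinity norm (maximum absolute row sum) of matrices; $\rho$ is the spectral radius; $e\in\mathbb{R}^n$ is the all-ones vector; $I$ is the $n\times n$ identity; $\otimes$ is the Kronecker product (so $x\otimes I$ and $I\otimes x$ are $n^2\times n$ for $x\in\mathbb{R}^n$); inequalities between vectors or matrices are entrywise. A Markovian binary tree (MBT) on $n$ states enters only through the coefficients $a\in\mathbb{R}^n$, $B\in\mathbb{R}^{n\times n^2}$ of its quadratic vector equation (QVE) $x=a+B(x\otimes x)$, $x\in\mathbb{R}^n$. These satisfy: (P1) all entries of $a$ and $B$ lie between $0$ and $1$; (P2) $e=a+B(e\otimes e)$. The MBT is supercritical and positive regular (an SPR-MBT) if moreover (P3) the nonnegative $n\times n$ matrix $R=B(I\otimes e+e\otimes I)$ is irreducible and $\rho(R)>1$. The extinction probability $x^{\ast}$ of the MBT is the minimal nonnegative solution of the QVE, i.e. the solution $x^{\ast}\ge 0$ with $x^{\ast}\le y$ for every solution $y\ge0$. For an SPR-MBT it is known that $0\le x^{\ast}<e$, that $x^{\ast}$ is the only solution of the QVE in $\{x: 0\le x<e\}$, that $\rho(B(x^{\ast}\otimes I+I\otimes x^{\ast}))<1$, and that $(I-B(x^{\ast}\otimes I+I\otimes x^{\ast}))^{-1}$ exists and is nonnegative. *)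

(* Defs.v *)
From HB Require Import structures.
From mathcomp Require Import all_boot all_order all_algebra.
From mathcomp Require Import all_classical all_reals all_analysis.
From mathcomp Require Export complex mxtens.

Set Implicit Arguments.
Unset Strict Implicit.
Unset Printing Implicit Defensive.

Import Order.TTheory GRing.Theory Num.Theory.
Import numFieldNormedType.Exports.

Local Open Scope classical_set_scope.
Local Open Scope ring_scope.

(* For column vectors the library norm `|x| is the infinity norm.  For general
   matrices it is the largest modulus of an entry, which is not the induced
   infinity norm (maximum absolute row sum); the latter is infnorm. *)
Definition infnorm (R : realType) (m n : nat) (A : 'M[R]_(m, n)) : R :=
  \big[Num.max/0]_(i < m) \sum_(j < n) `|A i j|.

(* The eigenvalues are the complex ones.  They form a finite set, so the sup is
   a maximum, except for n = 0 where it is 0. *)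
Definition spectral_radius (R : realType) (n : nat) (A : 'M[R]_n) : R :=
  sup [set Normc.normc z | z in
        [set z : R[i] | eigenvalue (map_mx (@real_complex R) A) z]].

(* A is reducible when some proper nonempty set S of indices is closed under
   the edges i -> j of the graph of A (those with A i j != 0), i.e. when
   listing S last makes A block upper triangular. *)
Definition irreducible_mx (R : realType) (n : nat) (A : 'M[R]_n) : Prop :=
  forall S : {set 'I_n}, S != finset.set0 -> S != [set: 'I_n]%SET ->
    exists i j, [/\ i \in S, j \notin S & A i j != 0].

Definition ones (R : realType) (n : nat) : 'cV[R]_n := const_mx 1.

(* tensmx is the Kronecker product, (i, j) having index i * n + j; the casts
   only replace the column counts 1 * n and n * 1 by n. *)
Definition kron_vv (R : realType) (n : nat) (x : 'cV[R]_n) : 'cV[R]_(n * n) :=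
  tensmx x x.

Definition kron_vI (R : realType) (n : nat) (x : 'cV[R]_n) :
    'M[R]_(n * n, n) :=
  castmx (erefl, mul1n n) (tensmx x (1%:M : 'M[R]_n)).

Definition kron_Iv (R : realType) (n : nat) (x : 'cV[R]_n) :
    'M[R]_(n * n, n) :=
  castmx (erefl, muln1 n) (tensmx (1%:M : 'M[R]_n) x).

Definition qve_solution (R : realType) (n : nat) (a : 'cV[R]_n)
    (B : 'M[R]_(n, n * n)) (x : 'cV[R]_n) : Prop :=
  x = a + B *m kron_vv x.

Definition MBT (R : realType) (n : nat) (a : 'cV[R]_n)
    (B : 'M[R]_(n, n * n)) : Prop :=
  [/\ forall i, 0 <= a i 0 <= 1,
      forall i j, 0 <= B i j <= 1
    & ones R n = a + B *m kron_vv (ones R n)].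

Definition SPR_MBT (R : realType) (n : nat) (a : 'cV[R]_n)
    (B : 'M[R]_(n, n * n)) : Prop :=
  let M := B *m (kron_Iv (ones R n) + kron_vI (ones R n)) in
  [/\ MBT a B, irreducible_mx M & 1 < spectral_radius M].

Definition extinction_probability (R : realType) (n : nat) (a : 'cV[R]_n)
    (B : 'M[R]_(n, n * n)) (x : 'cV[R]_n) : Prop :=
  [/\ qve_solution a B x,
      forall i, 0 <= x i 0
    & forall y : 'cV[R]_n, qve_solution a B y -> (forall i, 0 <= y i 0) ->
        forall i, x i 0 <= y i 0].

(* Main.v *)
(** Subtracting the equations of x and e, one finds that x + z solves the
    perturbed equation iff
      L z = DB (x (x) x - e (x) e) + DB (x (x) z + z (x) x) + B' (z (x) z),
    a fixed-point equation z = phi z whose scalar majorant has smallest root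
    xi.  On the ball of radius xi the map phi is a nonexpansive self-map, hence
    has a fixed point z by compactness.  The second hypothesis says
    xi < 1 - |x| and xi < 1 - |e - x|, so that 0 <= x + z < e, and x + z is then
    the extinction probability x' because a solution in [0, e) is unique.
    Both this uniqueness and the invertibility of L come from comparing with
    the positive vector v = e - y, for y a solution in [0, e), which satisfies
      v = B (y (x) v + v (x) y) + B (v (x) v).
    To take y = x one needs x < e, which xi >= 0 and xi < 1 - |x| force. *)
Require Import Defs.
From mathcomp Require Import all_boot all_order all_algebra.
From mathcomp Require Import all_classical all_reals all_analysis.
From mathcomp Require Import ring lra.
Import Order.TTheory GRing.Theory Num.Theory.
Import numFieldNormedType.Exports.
Local Open Scope ring_scope.

Set Implicit Arguments.
Unset Strict Implicit.
Unset Printing Implicit Defensive.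

(** * Compactness and fixed points of nonexpansive maps *)

Lemma lipschitz_within_continuous (R : realType) (V W : normedModType R)
    (k : R) (A : set V) (f : V -> W) :
  (forall x y, A x -> A y -> `|f x - f y| <= k * `|x - y|) ->
  {within A, continuous f}%classic.
Proof.
move=> fk; apply/subspace_continuousP => x Ax; apply/cvgrPdist_le => e e0.
(* The sign of [k] is free; [|k| + 1] is a positive Lipschitz constant, by which one can divide. *)
have k0 : 0 < `|k| + 1 by rewrite ltr_wpDl.
rewrite !near_withinE; near=> y => Ay.
apply: (le_trans (fk _ _ Ax Ay)).
apply: (@le_trans _ _ ((`|k| + 1) * `|x - y|)).
  by rewrite ler_wpM2r// (le_trans (ler_norm _))// lerDl.
rewrite -ler_pdivlMl//; near: y.
by apply: cvgr_dist_le => //; rewrite mulr_gt0// invr_gt0.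
Unshelve. all: by end_near. Qed.

Lemma closed_ball0_compact (R : realType) (n : nat) (r : R) :
  compact [set z : 'rV[R]_n | `|z| <= r]%classic.
Proof.
apply: bounded_closed_compact.
  exists r; split; first exact: num_real.
  by move=> M rM z /= zr; rewrite (le_trans zr)// ltW.
have -> : [set z : 'rV[R]_n | `|z| <= r]%classic
    = ((fun z : 'rV[R]_n => `|z|) @^-1` [set t | t <= r])%classic by [].
apply: closed_comp; last exact: closed_le.
by move=> z _; exact: norm_continuous.
Qed.

(* For t < 1 the map t *: f is a contraction, so the minimum of |z - t *: f z|
   over the compact ball is 0; letting t tend to 1, so is that of |z - f z|. *)
Lemma nonexpansive_fixpoint (R : realType) (n : nat)
    (f : 'rV[R]_n -> 'rV[R]_n) (r : R) :
  0 <= r ->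
  (forall z, `|z| <= r -> `|f z| <= r) ->
  (forall z w, `|z| <= r -> `|w| <= r -> `|f z - f w| <= `|z - w|) ->
  exists2 z, `|z| <= r & f z = z.
Proof.
move=> r0 fr fne.
have minE t : 0 <= t <= 1 -> exists2 c : 'rV[R]_n, `|c| <= r &
    forall z, `|z| <= r -> `|c - t *: f c| <= `|z - t *: f z|.
  move=> /andP[t0 t1].
  have [||c cA cmin] := @EVT_min_rV R n (fun z => `|z - t *: f z|)
    [set z | `|z| <= r]%classic _ (@closed_ball0_compact R n r).
  - by exists 0; rewrite /= normr0.
  - apply: (@lipschitz_within_continuous _ _ R^o 2) => x y /= xr yr.
    apply: (le_trans (ler_dist_dist _ _)).
    have -> : x - t *: f x - (y - t *: f y) = x - y - t *: (f x - f y).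
      by apply/rowP => j; rewrite !mxE; ring.
    rewrite (le_trans (ler_normB _ _))// mulr2n mulrDl !mul1r lerD2l.
    by rewrite normrZ ger0_norm// (le_trans _ (fne _ _ xr yr))// ler_piMl.
  exists c => [|z zr]; first by move: cA; rewrite inE.
  by apply: cmin; rewrite inE.
have [|c cr cmin] := minE 1; first by rewrite ler01 lexx.
have {}cmin z : `|z| <= r -> `|c - f c| <= `|z - f z|.
  by move=> /cmin; rewrite !scale1r.
exists c => //; apply/esym/subr0_eq/eqP; rewrite -normr_le0.
apply/ler_addgt0Pr => e e0; rewrite add0r.
(* Chosen so that [t < 1] and [(1 - t) * r = e * t <= e]. *)
pose t := r / (r + e).
have re0 : 0 < r + e by rewrite ltr_wpDl.
have t0 : 0 <= t by rewrite divr_ge0// ltW.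
have t1 : t < 1 by rewrite ltr_pdivrMr// mul1r ltrDl.
have [|z zr zmin] := minE t; first by rewrite t0 ltW.
have tfr w : `|w| <= r -> `|t *: f w| <= r.
  move=> wr; rewrite normrZ ger0_norm// (le_trans _ (fr _ wr))//.
  by rewrite ler_piMl// ltW.
(* Testing the minimality of [z] at [t *: f z] bounds the minimum by [t < 1] times itself, so it is
   0. *)
have zE : z = t *: f z.
  apply/subr0_eq/eqP; rewrite -normr_le0.
  have := zmin _ (tfr _ zr); rewrite -scalerBr normrZ ger0_norm//.
  move=> /le_trans/(_ (ler_wpM2l t0 (fne _ _ zr (tfr _ zr)))).
  by rewrite -subr_le0 -[X in X - _]mul1r -mulrBl pmulr_rle0// subr_gt0.
have zfE : z - f z = (t - 1) *: f z by rewrite scalerBl scale1r -zE.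
rewrite (le_trans (cmin _ zr))// zfE normrZ distrC.
rewrite ger0_norm ?subr_ge0 ?(ltW t1)//.
apply: (@le_trans _ _ ((1 - t) * r)).
  by rewrite ler_wpM2l ?fr// subr_ge0 ltW.
have -> : (1 - t) * r = e * t by rewrite /t; field; rewrite gt_eqF.
by rewrite ler_piMr// ltW.
Qed.

(** * Kronecker products of vectors *)

Section Kronecker.
Variables (R : realType) (n : nat).
Implicit Types (u v w : 'cV[R]_n) (B : 'M[R]_(n, n * n)).

(** Polarised form of [kron_vv]: [kron_vv x] is [tensv x x] by conversion. *)
Definition tensv u v : 'cV[R]_(n * n) := tensmx u v.

Lemma tensvE u v k :
  tensv u v k 0 = u (mxtens_unindex k).1 0 * v (mxtens_unindex k).2 0.
Proof. by rewrite mxE [in LHS]ord1 [in X in _ * X]ord1. Qed.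

Lemma kron_vIE u k j : kron_vI u k j =
  u (mxtens_unindex k).1 0 * ((mxtens_unindex k).2 == j)%:R.
Proof.
rewrite castmxE mxE cast_ord_id [in X in X * _]ord1; congr (_ * _).
rewrite mxE; congr (_ %:R); congr (nat_of_bool (_ == _)).
by apply: val_inj; rewrite /= modn_small.
Qed.

Lemma kron_IvE u k j : kron_Iv u k j =
  ((mxtens_unindex k).1 == j)%:R * u (mxtens_unindex k).2 0.
Proof.
rewrite castmxE mxE cast_ord_id [in X in _ * X]ord1; congr (_ * _).
rewrite mxE; congr (_ %:R); congr (nat_of_bool (_ == _)).
by apply: val_inj; rewrite /= divn1.
Qed.

Lemma kron_vI_mul u v : kron_vI u *m v = tensv u v.
Proof.
apply/colP => k; rewrite tensvE mxE (bigD1 (mxtens_unindex k).2)//=.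
rewrite big1 ?addr0 => [|j jk]; first by rewrite kron_vIE eqxx mulr1.
by rewrite kron_vIE eq_sym (negbTE jk) mulr0 mul0r.
Qed.

Lemma kron_Iv_mul u v : kron_Iv u *m v = tensv v u.
Proof.
apply/colP => k; rewrite tensvE mxE (bigD1 (mxtens_unindex k).1)//=.
rewrite big1 ?addr0 => [|j jk]; first by rewrite kron_IvE eqxx mul1r mulrC.
by rewrite kron_IvE eq_sym (negbTE jk) !mul0r.
Qed.

End Kronecker.

(** * Row-sum norm of matrices against sup norm of vectors *)

Section Norms.
Variable R : realType.

Lemma mx_norm_leP m n (A : 'M[R]_(m, n)) (c : R) :
  0 <= c -> (forall i j, `|A i j| <= c) -> `|A| <= c.
Proof.
move=> c0 Ac; rewrite [leLHS]/Num.Def.normr/= mx_normrE.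
by apply/bigmax_leP; split=> // -[i j].
Qed.

Lemma mx_entry_le m n (A : 'M[R]_(m, n)) i j : `|A i j| <= `|A|.
Proof.
rewrite [leRHS]/Num.Def.normr/= mx_normrE.
by apply/bigmax_geP; right => /=; exists (i, j).
Qed.

Lemma mx_norm_tr m n (A : 'M[R]_(m, n)) : `|A^T| = `|A|.
Proof.
by apply/eqP; rewrite eq_le; apply/andP; split; apply: mx_norm_leP => // i j;
  [rewrite mxE mx_entry_le|have := mx_entry_le A^T j i; rewrite mxE].
Qed.

Lemma infnorm_ge0 m n (A : 'M[R]_(m, n)) : 0 <= infnorm A.
Proof.
rewrite /infnorm; elim/big_ind: _ => // [u v u0 v0|i _]; last exact: sumr_ge0.
by rewrite le_max u0.
Qed.

Lemma norm_mulmx_le m n (A : 'M[R]_(m, n)) (v : 'cV[R]_n) :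
  `|A *m v| <= infnorm A * `|v|.
Proof.
apply: mx_norm_leP => [|i j]; first by rewrite mulr_ge0// infnorm_ge0.
rewrite mxE (le_trans (ler_norm_sum _ _ _))//.
apply: (@le_trans _ _ ((\sum_k `|A i k|) * `|v|)).
  by rewrite mulr_suml ler_sum// => k _; rewrite normrM ler_wpM2l// mx_entry_le.
by rewrite ler_wpM2r//; apply: (le_bigmax 0 (fun i => \sum_k `|A i k|)).
Qed.

Lemma norm_tensv_le n (u v : 'cV[R]_n) : `|tensv u v| <= `|u| * `|v|.
Proof.
apply: mx_norm_leP => [|k j]; first by rewrite mulr_ge0.
by rewrite ord1 tensvE normrM ler_pM// mx_entry_le.
Qed.

End Norms.

(** Transposition is a linear isometry, so the row-vector case carries over to the columns of the
    equation. *)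
Lemma nonexpansive_fixpoint_col (R : realType) (n : nat)
    (f : 'cV[R]_n -> 'cV[R]_n) (r : R) :
  0 <= r ->
  (forall z, `|z| <= r -> `|f z| <= r) ->
  (forall z w, `|z| <= r -> `|w| <= r -> `|f z - f w| <= `|z - w|) ->
  exists2 z, `|z| <= r & f z = z.
Proof.
move=> r0 fr fne.
have [|z zr|z w zr wr|z zr fz] :=
    @nonexpansive_fixpoint R n (fun z => (f z^T)^T) r.
- exact: r0.
- by rewrite mx_norm_tr fr// mx_norm_tr.
- by rewrite -linearB mx_norm_tr -(mx_norm_tr (z - w)) linearB fne// mx_norm_tr.
- by exists z^T; rewrite ?mx_norm_tr// -[in RHS]fz trmxK.
Qed.

(** * Comparison with [e - y]: invertibility and uniqueness *)

Section QVE.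
Variables (R : realType) (n : nat) (a : 'cV[R]_n) (B : 'M[R]_(n, n * n)).
Hypothesis B_ge0 : forall i k, 0 <= B i k.
Hypothesis ones_sol : qve_solution a B (ones R n).
Implicit Types y p w : 'cV[R]_n.
Let tv := @tensv R n.

(* At an index i maximising the ratio t = w i / v i, where v = e - y, one gets
   t * v i <= t * (v i - (B (v (x) v)) i), which forces row i of B, and hence
   v i, to vanish. *)
Lemma subsolution_eq0 y p w :
  qve_solution a B y -> (forall i, y i 0 < 1) ->
  (forall i, 0 <= p i 0 <= y i 0) ->
  (forall i, 0 <= w i 0 <= (B *m (tv p w + tv w p)) i 0) -> w = 0.
Proof.
move=> ysol y1 py wB; pose v : 'cV[R]_n := ones R n - y.
have v0 i : 0 < v i 0 by rewrite !mxE subr_gt0.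
have vE : v = B *m (tv y v + tv v y) + B *m tv v v.
  rewrite -mulmxDr.
  rewrite (_ : _ + _ + _ = tv (ones R n) (ones R n) - tv y y); last first.
    by apply/colP => k; rewrite !(tensvE, mxE); ring.
  rewrite mulmxBr [in LHS]/v [in LHS]ones_sol [in LHS]ysol.
  by rewrite opprD addrACA subrr add0r.
have [//|w_neq0] := eqVneq w 0; exfalso.
have [i0 wi0] : exists i, w i 0 != 0.
  apply/existsP; apply: contraNT w_neq0; rewrite negb_exists => /forallP w0.
  by apply/eqP/colP => i; rewrite mxE; apply/eqP/negbNE.
pose i := [arg max_(j > i0) (w j 0 / v j 0)]%O.
pose t := w i 0 / v i 0.
have tmax j : w j 0 <= t * v j 0.
  rewrite -ler_pdivrMr//.
  by rewrite /t /i; case: (@arg_maxP _ _ _ i0 xpredT) => // k _; apply.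
have t0 : 0 < t.
  have := tmax i0; have /andP[w0 _] := wB i0.
  have := v0 i0; have : 0 < w i0 0 by rewrite lt_neqAle eq_sym wi0.
  by move=> ? ? /(lt_le_trans _)-/(_ 0); rewrite pmulr_lgt0//; apply.
have w_ge0 j : 0 <= w j 0 by case/andP: (wB j).
have wi : w i 0 = t * v i 0 by rewrite /t divfK// gt_eqF.
(* Entrywise, [p <= y] and [w <= t v], and [B] is nonnegative. *)
have : (B *m (tv p w + tv w p)) i 0 <= t * (B *m (tv y v + tv v y)) i 0.
  rewrite !mxE mulr_sumr ler_sum// => k _.
  rewrite mulrCA ler_wpM2l// !(tensvE, mxE) mulrDr.
  have H j j' : p j 0 * w j' 0 <= t * (y j 0 * v j' 0).
    have /andP[p0 pyj] := py j.
    by rewrite mulrCA ler_pM.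
  by have := H (mxtens_unindex k).1 (mxtens_unindex k).2;
     have := H (mxtens_unindex k).2 (mxtens_unindex k).1;
     rewrite !mxE; lra.
have /andP[_ /le_trans leB /leB{leB}] := wB i.
rewrite wi ler_pM2l// {1}vE mxE gerDl mxE => Bv.
have tv0 k : 0 < tv v v k 0 by rewrite tensvE mulr_gt0.
have Bi0 k : B i k = 0.
  have /eqP : \sum_k B i k * tv v v k 0 = 0.
    apply/eqP; rewrite eq_le Bv sumr_ge0// => j _.
    by rewrite mulr_ge0// ltW.
  rewrite psumr_eq0 => [/allP/(_ k)|j _]; last by rewrite mulr_ge0// ltW.
  by rewrite mem_index_enum mulf_eq0 (gt_eqF (tv0 k)) orbF => /(_ isT)/eqP.
have := v0 i; rewrite vE !mxE !big1 ?addr0 ?ltxx// => k _;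
  by rewrite Bi0 mul0r.
Qed.

(** If [L] kills a vector, the entrywise modulus [w] of that vector satisfies
    [w <= B (y (x) w + w (x) y)], hence vanishes by [subsolution_eq0] with [p = y]. *)
Lemma qve_jacobian_unit y :
  qve_solution a B y -> (forall i, 0 <= y i 0 < 1) ->
  1%:M - B *m (kron_vI y + kron_Iv y) \in unitmx.
Proof.
move=> ysol y01; set L := _ - _.
have y1 i : y i 0 < 1 by case/andP: (y01 i).
have y0 i : 0 <= y i 0 by case/andP: (y01 i).
rewrite -unitmx_tr unitmxE unitfE; apply/negP => /det0P[u u_neq0 uL].
have : L *m u^T = 0 by rewrite -[L]trmxK -trmx_mul uL trmx0.
rewrite /L mulmxBl mul1mx -mulmxA mulmxDl kron_vI_mul kron_Iv_mul.
move=> /subr0_eq uE; set w := u^T in uE.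
have wE : map_mx Num.norm w = 0.
  apply: (@subsolution_eq0 y y) => // i; first by rewrite y0 lexx.
  rewrite mxE normr_ge0/= {1}uE !mxE (le_trans (ler_norm_sum _ _ _))//.
  rewrite ler_sum// => k _; rewrite normrM (ger0_norm (B_ge0 _ _)).
  rewrite ler_wpM2l// !(tensvE, mxE) (le_trans (ler_normD _ _))//.
  by rewrite !normrM !(ger0_norm (y0 _)).
move: u_neq0; rewrite -trmx_eq0 -/w => /negP; apply; apply/eqP/colP => i.
by move/colP/(_ i): wE; rewrite !mxE => /normr0_eq0.
Qed.

(** With [w = y - x] and the midpoint [p] of [x] and [y], polarisation gives
    [w = B (p (x) w + w (x) p)]; minimality of [x] gives [0 <= w] and [p <= y]. *)
Lemma extinction_unique x y :
  extinction_probability a B x -> qve_solution a B y ->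
  (forall i, 0 <= y i 0 < 1) -> x = y.
Proof.
move=> [xsol x0 xmin] ysol y01.
have y1 i : y i 0 < 1 by case/andP: (y01 i).
have y0 i : 0 <= y i 0 by case/andP: (y01 i).
have xy i : x i 0 <= y i 0 by apply: xmin.
apply/esym/subr0_eq.
apply: (@subsolution_eq0 y (2^-1 *: (x + y))) => // i.
  by have := x0 i; have := xy i; rewrite !mxE; lra.
rewrite (_ : tv _ _ + _ = tv y y - tv x x); last first.
  by apply/colP => k; rewrite !(tensvE, mxE); field.
rewrite (_ : B *m _ = y - x) ?lexx ?andbT; first by rewrite !mxE subr_ge0.
by rewrite mulmxBr [in RHS]xsol [in RHS]ysol opprD addrACA subrr add0r.
Qed.

End QVE.

(** * The scalar majorant *)

(* xi is the smaller root of the fixed-point equation of the majorant,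
     l * (d * delta + 2 * delta * X * u + b * u ^ 2) = u.
   The junk case of a zero denominator is not excluded: then d * delta = 0 and
   xi = 0 is still a root. *)
Lemma majorant_root (R : realType) (X Y delta b d l : R) :
  0 <= X -> 0 <= delta -> 0 <= b -> 0 <= d -> 0 <= l ->
  let s := Num.sqrt ((1 - 2 * l * delta * X) ^+ 2
                     - 4 * l ^+ 2 * b * d * delta) in
  let xi := 2 * l * d * delta / (1 - 2 * l * delta * X + s) in
  X * delta + Num.sqrt (b * d * delta) <= 1 / (2 * l) ->
  Num.max (1 - 2 * l * b * (1 - X)) (1 - 2 * l * b * (1 - Y))
    < 2 * l * delta * X + s ->
  [/\ 0 <= xi, xi < 1 - X & xi < 1 - Y] /\
  [/\ l * (delta * d + delta * (2 * X * xi) + b * xi ^+ 2) <= xi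
    & l * (2 * delta * X + 2 * b * xi) <= 1].
Proof.
move=> X0 delta0 b0 d0 l0; set P := 1 - 2 * l * delta * X => s xi h1.
rewrite gt_max => /andP[h2 h3].
(* For [l = 0] the strict hypothesis would read [1 < 1]. *)
have l_gt0 : 0 < l.
  rewrite lt_neqAle l0 andbT eq_sym; apply: contraTneq h2 => l_eq0.
  rewrite /s /P l_eq0.
  by rewrite !(mulr0, mul0r, expr0n, subr0, expr1n, sqrtr1, add0r) ltxx.
set T := b * d * delta in h1.
have T0 : 0 <= T by rewrite !mulr_ge0.
have sT0 : 0 <= Num.sqrt T by apply: sqrtr_ge0.
have sT2 : Num.sqrt T ^+ 2 = T by rewrite sqr_sqrtr.
(* The square of this inequality says that the discriminant is nonnegative. *)
have {}h1 : 2 * l * Num.sqrt T <= P.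
  move: h1; rewrite ler_pdivlMr ?mulr_gt0// /P; lra.
have P0 : 0 <= P by rewrite (le_trans _ h1)// !mulr_ge0.
have D0 : 0 <= P ^+ 2 - 4 * l ^+ 2 * b * d * delta.
  have : (2 * l * Num.sqrt T) ^+ 2 <= P ^+ 2.
    by rewrite ler_sqr ?nnegrE// !mulr_ge0.
  by rewrite !exprMn sT2 /T; lra.
have s0 : 0 <= s by apply: sqrtr_ge0.
have s2 : s ^+ 2 = P ^+ 2 - 4 * l ^+ 2 * b * d * delta by rewrite sqr_sqrtr.
have sP : s <= P.
  by rewrite -ler_sqr ?nnegrE// s2 gerBl !mulr_ge0// sqr_ge0.
have ldd0 : 0 <= l * d * delta by rewrite !mulr_ge0.
have xi0 : 0 <= xi by apply: divr_ge0; [rewrite !mulr_ge0|rewrite addr_ge0].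
(* For [b = 0] the strict hypothesis would give [P < s]. *)
have b_gt0 : 0 < b.
  rewrite lt_neqAle b0 andbT eq_sym; apply: contraTneq h2 => ->.
  by rewrite !(mulr0, mul0r, subr0) -leNgt; move: sP; rewrite /P; lra.
have lb : 0 < l * b by rewrite mulr_gt0.
(* Rationalised form of the root. If [P + s = 0], then [P = s = 0] and the default value [xi = 0]
   agrees. *)
have xiE : 2 * (l * b) * xi = P - s.
  have [Ps|Ps] := eqVneq (P + s) 0.
    rewrite /xi Ps invr0 !mulr0.
    by apply/esym; lra.
  rewrite /xi; apply: (mulIf Ps); rewrite mulrA divfK//.
  have -> : (P - s) * (P + s) = P ^+ 2 - s ^+ 2 by ring.
  by rewrite s2; ring.
(* Multiplied by [2 * (l * b)], the conclusion is exactly the assumption. *)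
have below Z : 1 - 2 * l * b * (1 - Z) < 2 * l * delta * X + s -> xi < 1 - Z.
  move=> h; rewrite -(ltr_pM2l (_ : 0 < 2 * (l * b))) ?mulr_gt0//.
  by rewrite xiE /P; lra.
have xiD : xi * (P + s) = 2 * (l * d * delta).
  have [Ps|Ps] := eqVneq (P + s) 0; last by rewrite /xi divfK//; ring.
  have s_0 : s = 0 by lra.
  have P_0 : P = 0 by lra.
  have : (4 * (l * b)) * (l * d * delta) = 0.
    by have := s2; rewrite s_0 P_0; lra.
  by move=> /eqP; rewrite Ps mulf_eq0 => /orP[|/eqP ->]; [lra|rewrite !mulr0].
split; split => //; [exact: below|exact: below| |].
(* The mean of [P + s] and [P - s] is [P], so the right-hand side is
   [P * xi + (1 - P) * xi = xi]. *)
- have : l * (delta * d + delta * (2 * X * xi) + b * xi ^+ 2) =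
      (xi * (P + s) + xi * (2 * (l * b) * xi)) / 2 + (1 - P) * xi.
    by rewrite xiD /P; field.
  by rewrite xiE => ->; rewrite le_eqVlt; apply/orP; left; apply/eqP; field.
(* The Lipschitz constant equals [1 - s]; it is 1 when the discriminant vanishes, so a strict
   contraction cannot be expected. *)
- have -> : l * (2 * delta * X + 2 * b * xi) = (1 - P) + 2 * (l * b) * xi.
    by rewrite /P; ring.
  by rewrite xiE; lra.
Qed.

(** * The perturbed equation *)

(** The two majorant inequalities make [phi] a nonexpansive self-map of the ball of radius [xi]; the
    two strict bounds place [x + z] in [[0, e)]. *)
Lemma qve_perturbation_bound (R : realType) (n : nat)
    (a : 'cV[R]_n) (B : 'M[R]_(n, n * n)) (x : 'cV[R]_n)
    (a' : 'cV[R]_n) (B' : 'M[R]_(n, n * n)) (x' : 'cV[R]_n) (xi : R) :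
  let e := ones R n in
  let DB := B' - B in
  let L := 1%:M - B *m (kron_vI x + kron_Iv x) in
  let delta := infnorm DB in
  let l := infnorm (invmx L) in
  let b' := infnorm (B + DB) in
  let d := `|kron_vv x - kron_vv e| in
  (forall i k, 0 <= B i k) -> qve_solution a B e ->
  (forall i k, 0 <= B' i k) -> qve_solution a' B' e ->
  qve_solution a B x -> (forall i, 0 <= x i 0) ->
  extinction_probability a' B' x' ->
  0 <= xi -> xi < 1 - `|x| -> xi < 1 - `|e - x| ->
  l * (delta * d + delta * (2 * `|x| * xi) + b' * xi ^+ 2) <= xi ->
  l * (2 * delta * `|x| + 2 * b' * xi) <= 1 ->
  `|x' - x| <= xi.
Proof.
move=> e DB L delta l b' d B0 eB B'0 eB' xB x0 hx' xi0 xiX xiY xi_root xi_lip.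
have x1 i : 0 <= x i 0 < 1.
  rewrite x0/= (le_lt_trans (ler_norm _))// (le_lt_trans (mx_entry_le _ _ _))//.
  by rewrite -subr_gt0 (le_lt_trans xi0).
have L_unit : L \in unitmx.
  by rewrite /L; exact: (qve_jacobian_unit B0 eB xB x1).
pose tv := @tensv R n.
pose phi z := invmx L *m
  (DB *m (tv x x - tv e e) + DB *m (tv x z + tv z x) + B' *m tv z z).
have l0 : 0 <= l by apply: infnorm_ge0.
have delta0 : 0 <= delta by apply: infnorm_ge0.
have b0 : 0 <= b' by apply: infnorm_ge0.
have B'E : B + DB = B' by rewrite addrC subrK.
have nB' (v : 'cV[R]_(n * n)) : `|B' *m v| <= b' * `|v|.
  by rewrite /b' B'E; exact: norm_mulmx_le.
have phi_ball (z : 'cV[R]_n) : `|z| <= xi -> `|phi z| <= xi.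
  move=> zxi; apply: le_trans xi_root.
  rewrite (le_trans (norm_mulmx_le _ _))// ler_wpM2l//.
  rewrite (le_trans (ler_normD _ _))// lerD//; last first.
    rewrite (le_trans (nB' _))// ler_wpM2l// (le_trans (norm_tensv_le _ _))//.
    by rewrite expr2 ler_pM.
  rewrite (le_trans (ler_normD _ _))// lerD//; first exact: norm_mulmx_le.
  rewrite (le_trans (norm_mulmx_le _ _))// ler_wpM2l//.
  rewrite (le_trans (ler_normD _ _))//.
  have := norm_tensv_le x z; have := norm_tensv_le z x.
  have := ler_wpM2l (normr_ge0 x) zxi; rewrite -/tv; lra.
have phi_ne (z w : 'cV[R]_n) :
    `|z| <= xi -> `|w| <= xi -> `|phi z - phi w| <= `|z - w|.
  move=> zxi wxi.
  (* Bilinearity makes each term linear in [z - w]; the quadratic one is split asymmetrically, as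
     [z (x) (z - w) + (z - w) (x) w]. *)
  have -> : phi z - phi w = invmx L *m (DB *m (tv x (z - w) + tv (z - w) x)
      + B' *m (tv z (z - w) + tv (z - w) w)).
    have -> : tv x (z - w) + tv (z - w) x = tv x z + tv z x - (tv x w + tv w x).
      by apply/colP => k; rewrite !(tensvE, mxE); ring.
    have -> : tv z (z - w) + tv (z - w) w = tv z z - tv w w.
      by apply/colP => k; rewrite !(tensvE, mxE); ring.
    rewrite /phi -mulmxBr; congr (_ *m _).
    rewrite !(mulmxBr _ (_ + _)) (mulmxBr B').
    move: (DB *m (_ - _)) (DB *m (_ + tv z x)) (DB *m (_ + tv w x)).
    move: (B' *m tv z z) (B' *m tv w w).
    by move=> ? ? ? ? ?; apply/colP => k; rewrite !mxE; ring.
  rewrite (le_trans (norm_mulmx_le _ _))//.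
  rewrite -[leRHS]mul1r; apply: le_trans (ler_wpM2r (normr_ge0 (z - w)) xi_lip).
  rewrite -/l -(mulrA l) ler_wpM2l// mulrDl.
  rewrite (le_trans (ler_normD _ _))// lerD//.
    rewrite (le_trans (norm_mulmx_le _ _))// [2 * delta]mulrC.
    rewrite -!mulrA ler_wpM2l//.
    rewrite (le_trans (ler_normD _ _))//.
    have := norm_tensv_le x (z - w); have := norm_tensv_le (z - w) x.
    rewrite -/tv; lra.
  rewrite (le_trans (nB' _))// [2 * b']mulrC -!mulrA ler_wpM2l//.
  rewrite (le_trans (ler_normD _ _))//.
  have := norm_tensv_le z (z - w); have := norm_tensv_le (z - w) w.
  have := ler_wpM2r (normr_ge0 (z - w)) zxi.
  have := ler_wpM2r (normr_ge0 (z - w)) wxi; rewrite -/tv; lra.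
have [z zxi phiz] := nonexpansive_fixpoint_col xi0 phi_ball phi_ne.
have Lz : L *m z =
    DB *m (tv x x - tv e e) + DB *m (tv x z + tv z x) + B' *m tv z z.
  by rewrite -{1}phiz mulKVmx.
have y_sol : qve_solution a' B' (x + z).
  have tvE : kron_vv (x + z) = tv x x + (tv x z + tv z x) + tv z z.
    by apply/colP => k; rewrite [LHS]tensvE !(tensvE, mxE); ring.
  have xB1 : x = a + B *m tv x x by exact: xB.
  have eB1 : e = a + B *m tv e e by exact: eB.
  have eB1' : e = a' + B' *m tv e e by exact: eB'.
  rewrite /L mulmxBl mul1mx -mulmxA mulmxDl kron_vI_mul kron_Iv_mul in Lz.
  rewrite /DB (mulmxBr _ (tv x x)) !mulmxBl in Lz.
  rewrite /qve_solution tvE (mulmxDr B' (_ + _)) (mulmxDr B' (tv x x)).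
  (* With the matrix products opaque, each coordinate is a linear combination of four equations;
     those for [e] eliminate [a] and [a']. *)
  move: xB1 eB1 eB1' Lz.
  move: (B *m tv x x) (B' *m tv x x) (B *m tv e e) (B' *m tv e e).
  move: (B *m (_ + _)) (B' *m (_ + _)) (B' *m tv z z).
  move=> u1 u2 u3 u4 u5 u6 u7 /colP xB1 /colP eB1 /colP eB1' /colP Lz.
  apply/colP => i; move: (xB1 i) (eB1 i) (eB1' i) (Lz i).
  by rewrite !mxE; lra.
(* [xi < 1 - |e - x|] gives [x i 0 > xi], hence the lower bound; [xi < 1 - |x|] gives the upper
   one. *)
have y01 i : 0 <= (x + z) i 0 < 1.
  have := le_lt_trans (mx_entry_le x i 0) (_ : _ < 1 - xi).
  have := le_lt_trans (mx_entry_le (e - x) i 0) (_ : _ < 1 - xi).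
  have := le_trans (mx_entry_le z i 0) zxi.
  rewrite !mxE !ltr_norml ler_norml => /andP[? ?].
  move=> /(_ ltac:(lra))/andP[? ?] /(_ ltac:(lra))/andP[? ?].
  by apply/andP; split; lra.
rewrite (extinction_unique B'0 eB' hx' y_sol y01) addrAC subrr add0r.
exact: zxi.
Qed.

Theorem theorem2p1 (R : realType) (n : nat)
    (a : 'cV[R]_n) (B : 'M[R]_(n, n * n)) (x : 'cV[R]_n)
    (a' : 'cV[R]_n) (B' : 'M[R]_(n, n * n)) (x' : 'cV[R]_n)
    (hab : SPR_MBT a B) (hx : extinction_probability a B x)
    (hab' : SPR_MBT a' B') (hx' : extinction_probability a' B' x') :
  let e := ones R n in
  let DB := B' - B in
  let L := 1%:M - B *m (kron_vI x + kron_Iv x) in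
  let delta := infnorm DB in
  let l := infnorm (invmx L) in
  let b' := infnorm (B + DB) in
  let d := `|kron_vv x - kron_vv e| in
  let s := Num.sqrt ((1 - 2 * l * delta * `|x|) ^+ 2
                     - 4 * l ^+ 2 * b' * d * delta) in
  `|x| * delta + Num.sqrt (b' * d * delta) <= 1 / (2 * l) ->
  Num.max (1 - 2 * l * b' * (1 - `|x|)) (1 - 2 * l * b' * (1 - `|e - x|))
    < 2 * l * delta * `|x| + s ->
  `|x' - x| <= 2 * l * d * delta / (1 - 2 * l * delta * `|x| + s).
Proof.
move=> e DB L delta l b' d s h1 h2.
have [[_ B01 eB] _ _] := hab; have [[_ B'01 eB'] _ _] := hab'.
have [xB x0 _] := hx.
have B0 i k : 0 <= B i k by case/andP: (B01 i k).
have B'0 i k : 0 <= B' i k by case/andP: (B'01 i k).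
have [[xi0 xiX xiY] [xi_root xi_lip]] := majorant_root (normr_ge0 _)
  (infnorm_ge0 _) (infnorm_ge0 _) (normr_ge0 _) (infnorm_ge0 _) h1 h2.
exact: (qve_perturbation_bound B0 eB B'0 eB' xB x0 hx'
  xi0 xiX xiY xi_root xi_lip).
Qed.
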